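(* Let $G\in\mathcal{G}(n)$. For any computation schedule evaluating $G$ in the two-level memory model with a cache of $M$ words and block size $B\ge 1$, in which no vertex value is computed more than once, the number of I/O operations is at least $$IO_G(n,M,B)\ \ge\ \max\left\{\frac{n^3-n}{16\sqrt{M}}-\frac{n(n+1)}{2}-3M,\ n\right\}\frac{1}{B}.$$
   Context: For a positive integer $n$, the family $\mathcal{G}(n)$ consists of all CDAGs (computational DAGs) built as follows. There are $R$-vertices $v_{i,j}$ for all $1\le i\le j\le n$; the vertices $v_{i,i}$ are the input vertices. For every pair $i<j$ the CDAG contains a directed binary tree with exactly $j-i$ leaves, all of whose edges are directed towards its root $v_{i,j}$; the shape of each tree is arbitrary and trees for distinct pairs are vertex-disjoint. For $k\in\{0,\dots,j-i-1\}$ the $k$-th leaf of the tree rooted at $v_{i,j}$ has exactly two predecessors, $v_{i,i+k}$ and $v_{i+k+1,j}$. Memory model: a cache of $M$ words and a slow memory of unbounded size; each vertex value occupies one word; the value of a vertex can be computed only when the values of all its predecessors are in the cache, and the result is placed in the cache; the inputs are initially only in slow memory; a read (resp. write) I/O operation moves up to $B$ words stored in consecutive locations from slow memory to cache (resp. from cache to slow memory). A computation schedule evaluates all vertices of $G$; $IO_G(n,M,B)$ is the minimum number of I/O operations over all schedules of the considered kind. Standing assumption: $n=2^a$ and $M=2^b$ for integers $a,b\ge 3$. *)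

(* Defs.v *)
From HB Require Import structures.
From mathcomp Require Import all_boot all_order all_algebra.

Set Implicit Arguments.
Unset Strict Implicit.
Unset Printing Implicit Defensive.

Record cdag := Cdag {
  vertex :> finType;
  edge : rel vertex;
  cdag_acyclic : forall x y, edge x y -> ~~ connect edge y x
}.

Arguments edge {c} x y.

Definition preds (G : cdag) (x : G) : {set G} := [set u | edge u x].

Definition is_input (G : cdag) (x : G) : bool := preds x == set0.

Definition sub_edge (G : cdag) (T : {set G}) : rel G :=
  [rel x y | [&& x \in T, y \in T & edge x y]].

(* The subgraph induced on T is a binary tree with all edges directed towards
   its root r. Internal vertices may have one or two children. *)
Record binary_intree (G : cdag) (T : {set G}) (r : G) : Prop := BinaryIntree {
  intree_root : r \in T;
  intree_parent : forall x, x \in T ->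
    #|[set y | sub_edge T x y]| = if x == r then 0 else 1;
  intree_binary : forall x, x \in T -> #|[set u | sub_edge T u x]| <= 2;
  intree_connected : forall x, x \in T -> connect (sub_edge T) x r
}.

Definition tree_leaves (G : cdag) (T : {set G}) : {set G} :=
  [set x in T | [forall u, ~~ sub_edge T u x]].

(* v i j is the R-vertex with indices 1 <= i <= j <= n, T i j the vertex set
   of the tree rooted at v i j if i < j (and {v i i} if i = j), and lf i j k its
   k-th leaf. Values outside these index ranges are irrelevant. A tree with a
   single leaf may consist of its root only, so that v i i.+1 may itself be a
   leaf. *)
Record family_structure (n : nat) (G : cdag) (v : nat -> nat -> G)
    (T : nat -> nat -> {set G}) (lf : forall i j : nat, 'I_(j - i) -> G) : Prop :=
  FamilyStructure {
  fam_cover : forall x : G, exists i j, [/\ 1 <= i, i <= j, j <= n & x \in T i j];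
  fam_disjoint : forall i j i' j' (x : G),
    1 <= i -> i <= j -> j <= n -> 1 <= i' -> i' <= j' -> j' <= n ->
    x \in T i j -> x \in T i' j' -> i = i' /\ j = j';
  fam_input : forall i, 1 <= i -> i <= n ->
    T i i = [set v i i] /\ preds (v i i) = set0;
  fam_tree : forall i j, 1 <= i -> i < j -> j <= n ->
    binary_intree (T i j) (v i j);
  fam_leaf_inj : forall i j, 1 <= i -> i < j -> j <= n -> injective (lf i j);
  fam_leaves : forall i j, 1 <= i -> i < j -> j <= n ->
    tree_leaves (T i j) = [set lf i j k | k : 'I_(j - i)];
  fam_leaf_preds : forall i j (k : 'I_(j - i)), 1 <= i -> i < j -> j <= n ->
    preds (lf i j k) = [set v i (i + k); v (i + k + 1) j];
  fam_internal_preds : forall i j (x : G), 1 <= i -> i < j -> j <= n ->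
    x \in T i j -> x \notin tree_leaves (T i j) -> preds x \subset T i j
}.

Definition in_family (n : nat) (G : cdag) : Prop :=
  exists v T lf, @family_structure n G v T lf.

Section MemoryModel.

Variables (G : cdag) (M B : nat).

(* A memory word is identified with the vertex whose value it holds; None is a
   slow-memory location that holds no vertex value. *)
Definition slow_memory := nat -> option G.

Record state := State { cache : {set G}; slow : slow_memory }.

(* Read l k      : copy the words at locations l, ..., l + k - 1 to the cache.
   Write l ws    : copy the cached words ws to l, ..., l + size ws - 1.
   Compute x D   : compute x; its value may take the place of the cached values
                   D, which may include operands of x.
   Discard D     : drop D from the cache. *)
Inductive operation :=
  | Read of nat & nat
  | Write of nat & seq G
  | Compute of G & {set G}
  | Discard of {set G}.

Definition block (s : slow_memory) (l k : nat) : {set G} :=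
  [set x | [exists i : 'I_k, s (l + i) == Some x]].

Definition update_slow (s : slow_memory) (l : nat) (ws : seq G) : slow_memory :=
  fun p => if (l <= p) && (p < l + size ws) then onth ws (p - l) else s p.

Definition exec (o : operation) (st : state) : state :=
  match o with
  | Read l k => State (cache st :|: block (slow st) l k) (slow st)
  | Write l ws => State (cache st) (update_slow (slow st) l ws)
  | Compute x D => State (x |: (cache st :\: D)) (slow st)
  | Discard D => State (cache st :\: D) (slow st)
  end.

Definition enabled (o : operation) (st : state) : bool :=
  match o with
  | Read l k => k <= B
  | Write l ws => (size ws <= B) && all (fun x => x \in cache st) ws
  | Compute x D => ~~ is_input x && (preds x \subset cache st)
  | Discard D => true
  end.

Fixpoint legal (st : state) (sch : seq operation) : bool :=
  if sch is o :: sch' then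
    [&& enabled o st, #|cache (exec o st)| <= M & legal (exec o st) sch']
  else true.

Definition initial (st : state) : Prop :=
  cache st = set0 /\
  forall x, (exists l, slow st l = Some x) <-> is_input x.

Definition computes (x : G) (o : operation) : bool :=
  if o is Compute y _ then y == x else false.

Definition evaluates_all (sch : seq operation) : Prop :=
  forall x : G, ~~ is_input x -> has (computes x) sch.

Definition no_recomputation (sch : seq operation) : Prop :=
  forall x : G, count (computes x) sch <= 1.

Definition is_io (o : operation) : bool :=
  match o with Read _ _ | Write _ _ => true | _ => false end.

Definition io_count (sch : seq operation) : nat := count is_io sch.

Definition computation_schedule (sch : seq operation) : Prop :=
  (exists2 st, initial st & legal st sch) /\ evaluates_all sch.

End MemoryModel.

(* Main.v *)
Require Import Defs.
From HB Require Import structures.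
From mathcomp Require Import all_boot all_order all_algebra.
From mathcomp Require Import zify ring lra.

(** Cut the schedule into segments that each compute [K] tree leaves, where
    [27 M^3 <= K^2 <= 256/9 M^3], and let [q] be the number of words moved plus
    the number of roots [v i j] computed during a segment. A leaf is a triple
    [(i, m, j)] with [i <= m < j]: it consumes [v i m] and [v m.+1 j] and
    contributes to [v i j]. Each operand is in cache when the segment starts, is
    read, or is a root computed meanwhile; in the absence of recomputation, each
    tree that is touched has its root computed in the segment, or leaves a vertex
    in cache or in slow memory for later. So the three projections of the set of
    leaves of the segment have at most [M + q] elements, Loomis-Whitney gives
    [K^2 <= (M + q)^3], hence [q >= 2 M]. It remains to sum over the segments:
    there are ['C(n + 1, 3)] leaves and [n (n + 1) / 2] roots in all. *)

Set Implicit Arguments.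
Unset Strict Implicit.
Unset Printing Implicit Defensive.

(** * Counting *)

(** Cauchy-Schwarz: sum [2 * (f c * f d) <= f c ^ 2 + f d ^ 2] over all pairs [(c, d)] and cancel
    2. *)
Lemma sqr_sum_leq_card_sum_sqr (I : finType) (C : {set I}) (f : I -> nat) :
  (\sum_(c in C) f c) ^ 2 <= #|C| * \sum_(c in C) f c ^ 2.
Proof.
set S := \sum_(c in C) f c ^ 2.
have H : \sum_(c in C) \sum_(d in C) 2 * (f c * f d) <=
         \sum_(c in C) \sum_(d in C) (f c ^ 2 + f d ^ 2).
  apply: leq_sum => c _; apply: leq_sum => d _; exact: nat_Cauchy.
have E1 : \sum_(c in C) \sum_(d in C) 2 * (f c * f d) =
          2 * (\sum_(c in C) f c) ^ 2.
  rewrite -mulnn big_distrl big_distrr /=; apply: eq_bigr => c _.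
  by rewrite -big_distrr -big_distrr.
have E2 : \sum_(c in C) \sum_(d in C) (f c ^ 2 + f d ^ 2) = 2 * (#|C| * S).
  under eq_bigr => c _ do rewrite big_split /= sum_nat_const.
  by rewrite big_split /= sum_nat_const -big_distrr /= -/S addnn mul2n.
by rewrite E1 E2 leq_pmul2l in H.
Qed.

(* The square of a fibre of the projection to [C] counts pairs [(m, m')]; such
   a pair over [(i, j)] is determined by [(i, m)] in [A] and [(m', j)] in [B]. *)
Lemma loomis_whitney (X Y Z : finType) (T : {set X * Y * Z})
    (A : {set X * Y}) (B : {set Y * Z}) (C : {set X * Z}) :
  (forall i m j, (i, m, j) \in T ->
     [/\ (i, m) \in A, (m, j) \in B & (i, j) \in C]) ->
  #|T| ^ 2 <= #|A| * #|B| * #|C|.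
Proof.
move=> TP; pose F (c : X * Z) := [set m | (c.1, m, c.2) \in T].
have cardT : #|T| = \sum_(c in C) #|F c|.
  rewrite -sum1_card (partition_big (fun t : X * Y * Z => (t.1.1, t.2))
    [in C]) /=; last by move=> [[i m] j] /TP[].
  apply: eq_bigr => -[i j] _; rewrite sum1dep_card.
  rewrite -(card_imset (F (i, j)) (f := fun m => (i, m, j))); last first.
    by move=> m m' [].
  apply: eq_card => -[[i' m] j']; rewrite inE /=; apply/andP/imsetP => /=.
    by case=> tT /eqP[<- <-]; exists m; rewrite ?inE.
  by case=> m'; rewrite inE /= => tT [-> -> ->].
rewrite cardT [leqRHS]mulnC.
apply: leq_trans (sqr_sum_leq_card_sum_sqr _ _) _.
rewrite leq_mul2l -cardsX; apply/orP; right.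
pose P := [set p : (X * Z) * (Y * Y) |
             (p.1 \in C) && (p.2 \in setX (F p.1) (F p.1))].
have -> : \sum_(c in C) #|F c| ^ 2 = #|P|.
  under eq_bigr => c _ do rewrite -mulnn -cardsX -sum1_card.
  by rewrite pair_big_dep sum1dep_card.
pose g (p : (X * Z) * (Y * Y)) := ((p.1.1, p.2.1), (p.2.2, p.1.2)).
rewrite -(card_imset _ (f := g)); last first.
  by move=> [[i j] [m m']] [[k l] [r s]] [-> -> -> ->].
apply/subset_leq_card/subsetP => q /imsetP[[[i j] [m m']]].
rewrite !inE /= => /and3P[_ /TP[? _ _] /TP[_ ? _]] ->.
by apply/andP.
Qed.

(** The constant [27 = 3 ^ 3] makes the Loomis-Whitney bound yield [3 * M <= M + q];
    [256 / 9 = (16 / 3) ^ 2] produces the final factor 16. The gap between them absorbs the rounding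
    of the least admissible [K], as [M ^ 3] is at least 512. *)
Lemma exists_segment_size M : 8 <= M ->
  exists2 K, 27 * M ^ 3 <= K ^ 2 & 9 * K ^ 2 <= 256 * M ^ 3.
Proof.
move=> M8; set Y := M ^ 3.
have Y512 : 512 <= Y by rewrite -[512]/(8 ^ 3) leq_exp2r.
have exK : exists K, 27 * Y <= K ^ 2.
  by exists (27 * Y); rewrite -mulnn leq_pmulr //; lia.
case: (ex_minnP exK) => K YK minK; exists K => //.
have K0 : 0 < K by case: K YK {minK}; lia.
have {minK} : K.-1 ^ 2 < 27 * Y.
  by rewrite ltnNge; apply/negP => /minK; lia.
rewrite -!mulnn in YK *; case: K K0 YK => [//|k] _ /= YK ltk.
by nia.
Qed.

Lemma sum_pos_leq n m : m <= n -> \sum_(i < n.+1) ((0 < i) && (i <= m)) = m.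
Proof.
elim: n m => [|n IH] m lemn; first by rewrite big_ord1 /=; lia.
rewrite big_ord_recr /=; case: (ltngtP m n.+1) lemn => // [ltmn|->] _.
  by rewrite IH ?addn0.
rewrite -[RHS]addn1 -[in RHS](IH n (leqnn n)); congr (_ + _).
by apply: eq_bigr => i _; have lti := ltn_ord i; congr (nat_of_bool (_ && _)); lia.
Qed.

Lemma card_index_pairs n :
  2 * #|[set p : 'I_n.+1 * 'I_n.+1 | (0 < p.1) && (p.1 <= p.2)]| = n * n.+1.
Proof.
rewrite cardsE -sum1_card big_mkcond /=.
rewrite -(pair_bigA _ (fun i j : 'I_n.+1 => if (0 < i) && (i <= j) then 1 else 0)).
rewrite exchange_big /= (eq_bigr (fun j : 'I_n.+1 => val j)) => [|j _]; last first.
  by rewrite -[RHS](@sum_pos_leq n) ?leq_ord.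
rewrite -(big_mkord predT id) bin2_sum.
by rewrite mulnC (bin_ffact n.+1 2) ffactnS ffactn1 mulnC.
Qed.

(** There are ['C(n.+1, 3)] triples; the identity [6 * 'C(n.+1, 3) = n ^ 3 - n] is stated without
    subtraction. *)
Lemma card_index_triples n :
  6 * #|[set t : 'I_n.+1 * 'I_n.+1 * 'I_n.+1 |
           [&& 0 < t.1.1, t.1.1 <= t.1.2 & t.1.2 < t.2]]| + n = n ^ 3.
Proof.
rewrite cardsE -sum1_card big_mkcond /=.
rewrite -(pair_bigA _ (fun (p : 'I_n.+1 * 'I_n.+1) (j : 'I_n.+1) =>
  if [&& 0 < p.1, p.1 <= p.2 & p.2 < j] then 1 else 0)) exchange_big /=.
(* For fixed [j], each [m < j] admits [m] values of [i], and these sum to ['C(j, 2)]. *)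
rewrite (eq_bigr (fun j : 'I_n.+1 => 'C(j, 2))) => [|j _]; last first.
  rewrite -(pair_bigA _ (fun i m : 'I_n.+1 =>
    if [&& 0 < i, i <= m & m < j] then 1 else 0)) exchange_big /=.
  rewrite -bin2_sum big_mkord (big_ord_widen n.+1 id) 1?ltnW // [RHS]big_mkcond.
  apply: eq_bigr => m _; case: ltnP => _; last first.
    by rewrite big1 // => i _; rewrite !andbF.
  rewrite -[RHS](@sum_pos_leq n) ?leq_ord //.
  by apply: eq_bigr => i _; rewrite andbT; case: ifP.
elim: n => [|n IH]; first by rewrite big_ord1.
rewrite big_ord_recr /= mulnDr.
have := bin_ffact n.+1 2; rewrite ffactnS ffactn1 /= (_ : 2`! = 2) //.
by rewrite !expnS !expn0 !muln1 in IH *; nia.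
Qed.

(** * Schedules *)

Section Schedules.

Variables (G : cdag) (M B : nat).

Implicit Types (st : state G) (o : operation G) (s : seq (operation G)) (x y : G).

Definition run st s : state G := foldl (fun st o => exec o st) st s.

Definition computed s : {set G} := [set x | has (computes x) s].

Definition op_read st o : {set G} :=
  if o is Read l k then block (slow st) l k else set0.

Definition op_written o : {set G} :=
  if o is Write _ ws then [set x in ws] else set0.

Fixpoint read_set st s : {set G} :=
  if s is o :: s' then op_read st o :|: read_set (exec o st) s' else set0.

Definition written s : {set G} := \bigcup_(o <- s) op_written o.

Definition in_slow st x : Prop := exists l, slow st l = Some x.

Definition avail st x : Prop := x \in cache st \/ in_slow st x.

Lemma legal_cat st s1 s2 :
  legal M B st (s1 ++ s2) = legal M B st s1 && legal M B (run st s1) s2.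
Proof. by elim: s1 st => //= o s1 IH st; rewrite IH !andbA. Qed.

Lemma card_cache_run st s :
  #|cache st| <= M -> legal M B st s -> #|cache (run st s)| <= M.
Proof. by elim: s st => //= o s IH st _ /and3P[_]; apply: IH. Qed.

(** A location holds at most one value, so sending a vertex of the block to an offset that holds it
    is injective. *)
Lemma card_block (t : slow_memory G) l k : #|block t l k| <= k.
Proof.
pose f (x : G) : option 'I_k := [pick i : 'I_k | t (l + i) == Some x].
rewrite -[k in leqRHS]card_ord -(card_imset 'I_k Some_inj).
rewrite -(@card_in_imset _ _ f).
  apply/subset_leq_card/subsetP => z /imsetP[x]; rewrite inE => /existsP[i ti].
  rewrite /f; case: pickP => [j _ ->|/(_ i)]; last by rewrite ti.
  exact: imset_f.
move=> x y; rewrite !inE => /existsP[i ti] /existsP[j tj]; rewrite /f.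
case: pickP => [i' /eqP ti'|/(_ i)]; last by rewrite ti.
case: pickP => [j' /eqP tj'|/(_ j)]; last by rewrite tj.
by case=> eij; move: ti'; rewrite eij tj' => -[].
Qed.

Lemma card_io_words st s : legal M B st s ->
  #|read_set st s| + #|written s| <= B * io_count s.
Proof.
rewrite /written; elim: s st => [|o s IH] st /=; first by rewrite big_nil !cards0.
case/and3P=> eno _ /IH{}IH; rewrite big_cons.
apply: leq_trans (_ : #|op_read st o| + #|op_written o| + (B * io_count s) <= _).
  apply: leq_trans (leq_add (leq_card_setU _ _) (leq_card_setU _ _)) _; lia.
rewrite /io_count /= mulnDr leq_add2r.
case: o eno {IH} => [l k|l ws|x D|D] /=; rewrite ?cards0 ?addn0 ?muln1 //.
  by move=> kB; apply: leq_trans (card_block _ _ _) kB.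
case/andP=> wsB _; rewrite add0n cardsE; apply: leq_trans wsB.
exact: card_size.
Qed.

Lemma cache_exec st o x : x \in cache (exec o st) ->
  [|| x \in cache st, x \in op_read st o | computes x o].
Proof.
case: o => [l k|l ws|y D|D] /=; rewrite ?in_setU ?in_setU1 ?in_setD ?in_set0 ?orbF //.
- by rewrite in_set1 eq_sym => /orP[->|/andP[_ ->]]; rewrite ?orbT.
- by case/andP.
Qed.

Lemma in_slow_exec st o x : in_slow (exec o st) x ->
  in_slow st x \/ x \in op_written o.
Proof.
case: o => [l k|l ws|y D|D] /=; try by left.
case=> p /=; rewrite /update_slow; case: ifP => [/andP[lp plt]|_] E; last first.
  by left; exists p.
by right; rewrite inE; apply/onthP; exists (p - l).
Qed.

Lemma in_slow_run st s x : in_slow (run st s) x ->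
  in_slow st x \/ x \in written s.
Proof.
rewrite /written; elim: s st => [|o s IH] st /=; first by left.
rewrite big_cons in_setU => /IH[/in_slow_exec[|->]|->]; rewrite ?orbT; auto.
Qed.

(** Reads and writes only copy values between the two memories, so a value present in neither can
    appear only by being computed. *)
Lemma avail_exec st o x : enabled B o st -> avail (exec o st) x ->
  avail st x \/ computes x o.
Proof.
move=> eno [/cache_exec/or3P[|xR|]|/in_slow_exec[|xW]]; try by [right|left; left|left; right].
- left; case: o xR {eno} => [l k||| ] /=; rewrite ?inE //.
  by case/existsP=> i /eqP E; right; exists (l + i).
- left; left; case: o xW eno => [|l ws||] /=; rewrite ?inE //.
  by move=> xws /andP[_ /allP]; apply.
Qed.

Lemma avail_run st s x : legal M B st s -> avail (run st s) x ->
  avail st x \/ x \in computed s.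
Proof.
elim: s st => [|o s IH] st /=; first by left.
case/and3P=> eno _ leg /(IH _ leg)[/(avail_exec eno)[]|]; rewrite !inE /=.
- by left.
- by move=> ->; right.
- by move=> ->; rewrite orbT; right.
Qed.

Lemma avail_initial st x : initial st -> avail st x -> is_input x.
Proof. by case=> c0 sl [|/sl //]; rewrite c0 inE. Qed.

Lemma card_cache_initial st : initial st -> #|cache st| <= M.
Proof. by case=> -> _; rewrite cards0. Qed.

(** The operand is in cache when [x] is computed; tracing it back, it was there at the start, was
    read, or was computed meanwhile. *)
Lemma operand_in_cache st s x y : legal M B st s -> x \in computed s -> edge y x ->
  y \in cache st :|: read_set st s :|: computed s.
Proof.
elim: s st => [|o s IH] st /=; first by rewrite inE.
case/and3P=> eno _ leg xs yx; move: xs; rewrite inE /= => /orP[xo|xs].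
  case: o xo eno {leg} => //= z D /eqP-> /andP[_ /subsetP sub].
  by rewrite !in_setU sub // inE.
have := IH _ leg; rewrite inE xs => /(_ isT yx).
rewrite !in_setU => /orP[/orP[|]|].
- by case/cache_exec/or3P => [->|->|yo]; rewrite ?orbT // [y \in computed _]inE /= yo !orbT.
- by move=> ->; rewrite !orbT.
- by rewrite !inE /= => ->; rewrite !orbT.
Qed.

(** Coarser variant that counts slow memory as a source; it serves for the parts of the schedule
    before and after a segment. *)
Lemma operand_avail st s x y : legal M B st s -> x \in computed s -> edge y x ->
  avail st y \/ y \in computed s.
Proof.
elim: s st => [|o s IH] st /=; first by rewrite inE.
case/and3P=> eno _ leg xs yx; move: xs; rewrite !inE /= => /orP[xo|xs].
  case: o xo eno {leg} => //= z D /eqP-> /andP[_ /subsetP sub].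
  by left; left; rewrite sub // inE.
have := IH _ leg; rewrite inE xs => /(_ isT yx)[/(avail_exec eno)[|->]|].
- by left.
- by right.
- by rewrite !inE => ->; rewrite orbT; right.
Qed.

Lemma computed_not_input st s x : legal M B st s -> x \in computed s -> ~~ is_input x.
Proof.
elim: s st => [|o s IH] st /=; first by rewrite inE.
case/and3P=> eno _ leg; rewrite inE /= => /orP[xo|xs]; last first.
  by apply: (IH _ leg); rewrite inE.
by case: o xo eno {leg} => //= z D /eqP-> /andP[].
Qed.

Lemma card_computed_leq (A : {set G}) s :
  #|computed s :&: A| <= count (fun o => [exists x in A, computes x o]) s.
Proof.
elim: s => [|o s IH]; first by rewrite /computed /= leqn0 cards_eq0 -subset0; apply/subsetP => x; rewrite !inE.
rewrite /=; apply: leq_trans (leq_add (leqnn _) IH).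
have -> : computed (o :: s) :&: A =
          [set x in A | computes x o] :|: (computed s :&: A).
  by apply/setP => x; rewrite !inE /= andb_orl [_ && computes x o]andbC.
apply: leq_trans (leq_card_setU _ _) _; rewrite leq_add2r.
case: existsP => [_|noA] /=; last first.
  rewrite leqn0 cards_eq0 -subset0; apply/subsetP => x; rewrite !inE => xA.
  by case: noA; exists x.
case: o => [l k|l ws|y D|D] /=;
  try by rewrite (eq_card0 (A := [set x in A | false])) // => x; rewrite !inE andbF.
rewrite -(cards1 y); apply/subset_leq_card/subsetP => x.
by rewrite !inE => /andP[_ /eqP->].
Qed.

(** Double counting: the operations are summed per vertex of [A], and without recomputation each
    computed vertex accounts for at most one. *)
Lemma count_computes_set (A : {set G}) s : no_recomputation s ->
  count (fun o => [exists x in A, computes x o]) s <= #|computed s :&: A|.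
Proof.
move=> nr.
have -> : count (fun o => [exists x in A, computes x o]) s =
          \sum_(x in A) count (computes x) s.
  elim: s {nr} => [|o s IH] /=; first by rewrite big1.
  rewrite big_split /= -IH; congr (_ + _).
  case: o => [l k|l ws|y D|D] /=.
  - by rewrite big1 //; case: existsP => // -[x]; rewrite andbF.
  - by rewrite big1 //; case: existsP => // -[x]; rewrite andbF.
  - have [yA|yA] := boolP (y \in A).
      rewrite (bigD1 y) //= eqxx big1 => [|x /andP[_ /negbTE]]; last first.
        by rewrite eq_sym => ->.
      by case: existsP => // -[]; exists y; rewrite yA /=.
    rewrite big1 => [|x xA]; last by case: eqP yA => // ->; rewrite xA.
    by case: existsP => // -[x /andP[xA /eqP yx]]; rewrite yx xA in yA.
  - by rewrite big1 //; case: existsP => // -[x]; rewrite andbF.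
rewrite -sum1_card (big_setID (computed s)) /= [X in _ + X]big1 => [|x]; last first.
  by rewrite !inE => /andP[xs _]; apply/eqP; rewrite -leqn0 leqNgt -has_count.
rewrite addn0 setIC; apply: leq_sum => x _; exact: nr.
Qed.

End Schedules.

(** The count grows by at most one per entry, so prefixes attain every intermediate value; this cuts
    off segments with exactly [K] leaves. *)
Lemma split_count (T : Type) (p : pred T) k (s : seq T) : k <= count p s ->
  exists s1 s2, s = s1 ++ s2 /\ count p s1 = k.
Proof.
elim: s k => [|o s IH] [|k] //=; try by exists [::]; eexists.
have [po|po] /= := boolP (p o) => le.
  by have [s1 [s2 [-> <-]]] := IH k le; exists (o :: s1), s2; rewrite /= po.
have [s1 [s2 [-> <-]]] := IH k.+1 le.
by exists (o :: s1), s2; rewrite /= (negbTE po).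
Qed.

Lemma computed_cat (G : cdag) (s1 s2 : seq (operation G)) :
  computed (s1 ++ s2) = computed s1 :|: computed s2.
Proof. by apply/setP => x; rewrite !inE has_cat. Qed.

Lemma no_recomputation_catl (G : cdag) (s1 s2 : seq (operation G)) :
  no_recomputation (s1 ++ s2) -> no_recomputation s1.
Proof. by move=> nr x; apply: leq_trans (nr x); rewrite count_cat leq_addr. Qed.

Lemma no_recomputation_catr (G : cdag) (s1 s2 : seq (operation G)) :
  no_recomputation (s1 ++ s2) -> no_recomputation s2.
Proof. by move=> nr x; apply: leq_trans (nr x); rewrite count_cat leq_addl. Qed.

Lemma no_recomputation_disjoint (G : cdag) (s1 s2 : seq (operation G)) x :
  no_recomputation (s1 ++ s2) -> x \in computed s1 -> x \notin computed s2.
Proof.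
move=> /(_ x); rewrite count_cat !inE has_count => le1 gt0.
by rewrite has_count -leqNgt; lia.
Qed.

(** * The family of CDAGs *)

Section Family.

Variables (n : nat) (G : cdag) (v : nat -> nat -> G) (T : nat -> nat -> {set G}).
Variable lf : forall i j : nat, 'I_(j - i) -> G.
Hypothesis FS : family_structure n v T lf.

(** Elements of ['I_n.+1] stand for the indices 1 to [n] themselves; the spare value 0 is
    excluded. *)
Definition index_pairs : {set 'I_n.+1 * 'I_n.+1} :=
  [set p : 'I_n.+1 * 'I_n.+1 | (0 < p.1) && (p.1 <= p.2)].

Definition index_triples : {set 'I_n.+1 * 'I_n.+1 * 'I_n.+1} :=
  [set t : 'I_n.+1 * 'I_n.+1 * 'I_n.+1 | [&& 0 < t.1.1, t.1.1 <= t.1.2 & t.1.2 < t.2]].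

(* The leaf of the tree rooted at [v i j] with predecessors [v i m] and
   [v m.+1 j]; meaningful only for [i <= m < j]. *)
Definition leaf i m j : G := oapp (@lf i j) (v i j) (insub (m - i)).

Definition root_vertices : {set G} :=
  [set v (nat_of_ord p.1) (nat_of_ord p.2) | p in index_pairs].

Definition leaf_vertices : {set G} :=
  [set leaf (nat_of_ord t.1.1) (nat_of_ord t.1.2) (nat_of_ord t.2)
    | t in index_triples].

Lemma root_in_tree i j : 0 < i -> i <= j -> j <= n -> v i j \in T i j.
Proof.
move=> i0; rewrite leq_eqVlt => /predU1P[<-|ltij] jn.
  by have [-> _] := fam_input FS i0 jn; rewrite inE.
exact: intree_root (fam_tree FS i0 ltij jn).
Qed.

Lemma leafE i m j : i <= m -> m < j ->
  exists2 k : 'I_(j - i), leaf i m j = lf k & val k = m - i.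
Proof.
move=> im mj; have lt : m - i < j - i by lia.
by exists (Ordinal lt) => //; rewrite /leaf insubT.
Qed.

Lemma leaf_in_tree i m j : 0 < i -> i <= m -> m < j -> j <= n ->
  leaf i m j \in T i j.
Proof.
move=> i0 im mj jn; have [k -> _] := leafE im mj.
have ij : i < j by lia.
have : lf k \in tree_leaves (T i j) by rewrite (fam_leaves FS) // imset_f.
by rewrite inE => /andP[].
Qed.

Lemma leaf_operands i m j : 0 < i -> i <= m -> m < j -> j <= n ->
  edge (v i m) (leaf i m j) /\ edge (v m.+1 j) (leaf i m j).
Proof.
move=> i0 im mj jn; have [k -> kE] := leafE im mj.
have ij : i < j by lia.
have /setP P := fam_leaf_preds FS k i0 ij jn.
have ikm : i + k = m by rewrite [nat_of_ord k]kE; lia.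
have := P (v i m); have := P (v m.+1 j); rewrite !inE ikm addn1 !eqxx orbT /=.
by move=> -> ->.
Qed.

(** Disjointness of the trees recovers [i] and [j]; injectivity of [lf i j] then recovers
    [m - i]. *)
Lemma leaf_inj i m j i' m' j' :
    0 < i -> i <= m -> m < j -> j <= n ->
    0 < i' -> i' <= m' -> m' < j' -> j' <= n ->
  leaf i m j = leaf i' m' j' -> [/\ i = i', m = m' & j = j'].
Proof.
move=> i0 im mj jn i'0 im' mj' jn' E.
have := leaf_in_tree i0 im mj jn; rewrite E => L.
have [ei ej] : i = i' /\ j = j'.
  by apply: (fam_disjoint FS) L (leaf_in_tree i'0 im' mj' jn'); lia.
subst i' j'; have [k Ek ek] := leafE im mj; have [k' Ek' ek'] := leafE im' mj'.
have ij : i < j by lia.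
have : k = k' by apply: (fam_leaf_inj FS i0 ij jn); rewrite -Ek -Ek'.
by move/(congr1 val); rewrite ek ek'; split => //; lia.
Qed.

Lemma tree_not_input i j x : 0 < i -> i < j -> j <= n -> x \in T i j ->
  ~~ is_input x.
Proof.
move=> i0 ij jn xT; rewrite /is_input; apply/set0Pn.
have [|nl] := boolP (x \in tree_leaves (T i j)).
  rewrite (fam_leaves FS) // => /imsetP[k _ ->].
  by exists (v i (i + k)); rewrite (fam_leaf_preds FS) // !inE eqxx.
move: nl; rewrite inE xT /= negb_forall => /existsP[u]; rewrite negbK.
by case/and3P=> _ _ ux; exists u; rewrite inE.
Qed.

(** The path from [x] to the root starts in [S] and ends outside it, so one of its edges leaves
    [S]. *)
Lemma tree_exit i j x (S : {set G}) : 0 < i -> i < j -> j <= n ->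
    x \in T i j -> x \in S -> v i j \notin S ->
  exists y z, [/\ y \in T i j, z \in T i j, edge y z, y \in S & z \notin S].
Proof.
move=> i0 ij jn xT xS rS.
have /connectP[p] := intree_connected (fam_tree FS i0 ij jn) xT.
elim: p x xT xS => [|z p IH] x xT xS /=; first by move=> _ E; rewrite E xS in rS.
case/andP=> /and3P[_ zT xz] pth lst.
by have [zS|zS] := boolP (z \in S); [apply: (IH z) | exists x, z].
Qed.

Lemma card_root_vertices : 2 * #|root_vertices| <= n * n.+1.
Proof. by rewrite -card_index_pairs leq_mul2l leq_imset_card. Qed.

Lemma leaf_inj_in :
  {in index_triples &, injective (fun t : 'I_n.+1 * 'I_n.+1 * 'I_n.+1 =>
     leaf (nat_of_ord t.1.1) (nat_of_ord t.1.2) (nat_of_ord t.2))}.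
Proof.
move=> [[i m] j] [[i' m'] j']; rewrite !inE /=.
move=> /and3P[i0 im mj] /and3P[i'0 im' mj'] E.
have [||/val_inj-> /val_inj-> /val_inj-> //] := leaf_inj i0 im mj _ i'0 im' mj' _ E.
  exact: leq_ord.
exact: leq_ord.
Qed.

Lemma card_leaf_vertices : 6 * #|leaf_vertices| + n = n ^ 3.
Proof. by rewrite card_in_imset ?card_index_triples //; apply: leaf_inj_in. Qed.

Definition op_leaf (o : operation G) := [exists x in leaf_vertices, computes x o].
Definition op_root (o : operation G) := [exists x in root_vertices, computes x o].

Definition owner (x : G) : option ('I_n.+1 * 'I_n.+1) :=
  [pick p in index_pairs | x \in T (nat_of_ord p.1) (nat_of_ord p.2)].

Lemma ownerE (p : 'I_n.+1 * 'I_n.+1) x : p \in index_pairs ->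
  x \in T (nat_of_ord p.1) (nat_of_ord p.2) -> owner x = Some p.
Proof.
move=> pP xT; rewrite /owner; case: pickP => [q|/(_ p)]; last by rewrite pP xT.
case/andP; move: pP; rewrite !inE => /andP[p1 p2] /andP[q1 q2] xT'.
case: p q p1 p2 q1 q2 xT xT' => i j [i' j'] /= i0 ij i'0 ij' xT xT'.
have [/val_inj-> /val_inj->] // := fam_disjoint FS i'0 ij' (leq_ord _) i0 ij (leq_ord _) xT' xT.
Qed.

(** Trees are disjoint, so [owner] is determined by membership, and distinct trees that meet [S]
    need distinct vertices of [S]. *)
Lemma card_owned (S : {set G}) (A : {set 'I_n.+1 * 'I_n.+1}) :
    {in A, forall p, p \in index_pairs /\
       exists2 y, y \in T (nat_of_ord p.1) (nat_of_ord p.2) & y \in S} ->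
  #|A| <= #|S|.
Proof.
move=> AS; rewrite -(card_imset A Some_inj).
apply: leq_trans (leq_imset_card owner S).
apply/subset_leq_card/subsetP => q /imsetP[p /AS[pP [y yT yS]] ->].
by apply/imsetP; exists y; rewrite // (ownerE pP).
Qed.

(** * Leaves computed in one segment *)

Section Segment.

Variables (M B : nat) (st : state G) (pre seg post : seq (operation G)).
Hypothesis st_init : initial st.
Hypothesis sch_legal : legal M B st (pre ++ seg ++ post).
Hypothesis sch_all : evaluates_all (pre ++ seg ++ post).
Hypothesis sch_nr : no_recomputation (pre ++ seg ++ post).

Let st1 := run st pre.
Let st2 := run st1 seg.

Let legal_pre : legal M B st pre.
Proof. by move: sch_legal; rewrite legal_cat => /andP[]. Qed.

Let legal_seg : legal M B st1 seg.
Proof. by move: sch_legal; rewrite !legal_cat => /and3P[]. Qed.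

Let legal_post : legal M B st2 post.
Proof. by move: sch_legal; rewrite !legal_cat => /and3P[]. Qed.

Let card_st1 : #|cache st1| <= M.
Proof. exact: card_cache_run (card_cache_initial M st_init) legal_pre. Qed.

Let card_st2 : #|cache st2| <= M.
Proof. exact: card_cache_run card_st1 legal_seg. Qed.

(* A tree entered but not finished during the segment leaves behind a vertex
   whose consumer is evaluated later; it survives in cache or was written. *)
Lemma unfinished_tree i j x : 0 < i -> i < j -> j <= n ->
    x \in T i j -> x \in computed seg -> v i j \notin computed seg ->
  exists2 y, y \in T i j & y \in cache st2 :|: written seg.
Proof.
move=> i0 ij jn xT xseg rseg.
have [y [z [yT zT yz yseg zseg]]] := tree_exit i0 ij jn xT xseg rseg.
have ni := tree_not_input i0 ij jn.
have ypre : y \notin computed pre.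
  apply: contraL yseg => /(no_recomputation_disjoint sch_nr).
  by rewrite computed_cat inE negb_or => /andP[].
have ypost : y \notin computed post.
  exact: no_recomputation_disjoint (no_recomputation_catr sch_nr) yseg.
(* Computing [z] before the segment would need [y] there, yet [y] is neither an input nor computed
   that early. *)
have zpost : z \in computed post.
  have : z \in computed (pre ++ seg ++ post) by rewrite inE sch_all ?ni.
  rewrite !computed_cat !in_setU (negbTE zseg) /= => /orP[zpre|//].
  have [/(avail_initial st_init)|] := operand_avail legal_pre zpre yz.
    by rewrite (negbTE (ni _ yT)).
  by rewrite (negbTE ypre).
exists y => //; rewrite in_setU.
(* The value of [y] needed later is in one of the memories at the end of the segment. If in slow
   memory, it was written during the segment, as it did not exist before. *)
have [[->//|/in_slow_run[yin|->]]|] := operand_avail legal_post zpost yz.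
- have [] := avail_run legal_pre (or_intror yin : avail _ _).
    by move/(avail_initial st_init); rewrite (negbTE (ni _ yT)).
  by rewrite (negbTE ypre).
- exact: orbT.
- by rewrite (negbTE ypost).
Qed.

Lemma segment_leaves :
  (count op_leaf seg) ^ 2 <= (M + (B * io_count seg + count op_root seg)) ^ 3.
Proof.
set q := B * _ + _.
have nrs := no_recomputation_catl (no_recomputation_catr sch_nr).
pose C := computed seg :&: root_vertices.
have rootC i j : 0 < i -> i <= j -> j <= n -> v i j \in computed seg -> v i j \in C.
  move=> i0 ij jn vc; rewrite inE vc /=; apply/imsetP.
  have jn1 : j < n.+1 by lia.
  have in1 : i < n.+1 by lia.
  by exists (Ordinal in1, Ordinal jn1); rewrite // inE /= i0.
(* [S1] holds every possible operand that is a root; [S2] holds a witness for every tree touched by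
   the segment. *)
pose S1 := cache st1 :|: read_set st1 seg :|: C.
pose S2 := cache st2 :|: written seg :|: C.
have io := card_io_words legal_seg.
have cC : #|C| <= count op_root seg := card_computed_leq _ _.
have cS1 : #|S1| <= M + q.
  have := leq_of_leqif (leq_card_setU (cache st1 :|: read_set st1 seg) C).
  have := leq_of_leqif (leq_card_setU (cache st1) (read_set st1 seg)); rewrite -/S1 /q; lia.
have cS2 : #|S2| <= M + q.
  have := leq_of_leqif (leq_card_setU (cache st2 :|: written seg) C).
  have := leq_of_leqif (leq_card_setU (cache st2) (written seg)); rewrite -/S2 /q; lia.
pose TT := [set t in index_triples | leaf (nat_of_ord t.1.1) (nat_of_ord t.1.2) (nat_of_ord t.2) \in computed seg].
have cT : count op_leaf seg <= #|TT|.
  apply: leq_trans (count_computes_set _ nrs) _.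
  rewrite -(@card_in_imset _ _ _ TT (sub_in2 _ leaf_inj_in)); last first.
    by move=> t; rewrite inE => /andP[].
  apply/subset_leq_card/subsetP => x; rewrite inE => /andP[xs /imsetP[t tP xE]].
  by apply/imsetP; exists t; rewrite // inE tP -xE.
(* [A], [D] and [E] contain the projections of [TT] to [(i, m)], [(m, j)] and [(i, j)]. In [D] the
   first index is shifted, since the right operand is [v m.+1 j]. *)
pose A := [set p in index_pairs | v (nat_of_ord p.1) (nat_of_ord p.2) \in S1].
pose D := [set p : 'I_n.+1 * 'I_n.+1 | (p.1 < p.2) && (v p.1.+1 (nat_of_ord p.2) \in S1)].
pose E := [set p in index_pairs | [exists y in S2, y \in T (nat_of_ord p.1) (nat_of_ord p.2)]].
have cA : #|A| <= M + q.
  apply: leq_trans cS1; apply: card_owned => p; rewrite inE => /andP[pP vS].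
  split=> //; exists (v (nat_of_ord p.1) (nat_of_ord p.2)) => //.
  by move: pP; rewrite inE => /andP[??]; apply: root_in_tree => //; exact: leq_ord.
have cD : #|D| <= M + q.
  apply: leq_trans cS1.
  rewrite -(@card_in_imset _ _ (fun p : 'I_n.+1 * 'I_n.+1 => v p.1.+1 (nat_of_ord p.2))).
    by apply/subset_leq_card/subsetP => x /imsetP[p]; rewrite inE => /andP[_ ?] ->.
  move=> [i j] [i' j']; rewrite !inE /= => /andP[ij _] /andP[ij' _] eqv.
  have := root_in_tree (ltn0Sn i) ij (leq_ord j); rewrite eqv => H.
  have [[/val_inj-> /val_inj->]] // := fam_disjoint FS (ltn0Sn i) ij (leq_ord j)
    (ltn0Sn i') ij' (leq_ord j') H (root_in_tree (ltn0Sn i') ij' (leq_ord j')).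
have cE : #|E| <= M + q.
  apply: leq_trans cS2; apply: card_owned => p; rewrite inE.
  by case/andP=> pP /existsP[y /andP[yS yT]]; split=> //; exists y.
apply: leq_trans (_ : #|TT| ^ 2 <= _); first by rewrite leq_sqr.
apply: leq_trans (_ : #|A| * #|D| * #|E| <= _); last first.
  by rewrite !expnS expn0 muln1 mulnA !leq_mul.
apply: loomis_whitney => i m j; rewrite inE [_ \in index_triples]inE /=.
move=> /andP[/and3P[i0 im mj] lc].
have jn := leq_ord j.
have im1 : i <= j by lia.
have ij1 : i < j by lia.
have [el er] := leaf_operands i0 im mj jn.
have opS a c : 0 < a -> a <= c -> c <= n -> edge (v a c) (leaf i m j) -> v a c \in S1.
  move=> a0 ac cn /(operand_in_cache legal_seg lc).
  by rewrite !in_setU => /orP[->//|/(rootC _ _ a0 ac cn)->]; rewrite orbT.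
split.
- by rewrite inE [_ \in index_pairs]inE /= i0 im opS // leq_ord.
- by rewrite inE /= mj opS.
- rewrite inE [_ \in index_pairs]inE /= i0 im1 /=; apply/existsP.
  have [rc|rc] := boolP (v i j \in computed seg).
    by exists (v i j); rewrite root_in_tree // in_setU (rootC _ _ i0 im1 jn rc) orbT.
  have [y yT yS] := unfinished_tree i0 ij1 jn (leaf_in_tree i0 im mj jn) lc rc.
  by exists y; rewrite yT andbT in_setU yS.
Qed.

End Segment.

(** * Summation over the whole schedule *)

Section WholeSchedule.

Variables (M B : nat) (st : state G) (sch : seq (operation G)).
Hypothesis st_init : initial st.
Hypothesis sch_legal : legal M B st sch.
Hypothesis sch_all : evaluates_all sch.
Hypothesis sch_nr : no_recomputation sch.

(** Every input is an operand of some leaf, is initially only in slow memory and is never computed,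
    hence must be read. *)
Lemma input_reads : 1 < n -> n <= B * io_count sch.
Proof.
move=> n1; apply: leq_trans (leq_trans (leq_addr _ _) (card_io_words sch_legal)).
rewrite -[leqLHS]card_ord.
rewrite -(@card_imset _ _ (fun i : 'I_n => v i.+1 i.+1)); last first.
  move=> i i' /= E; apply/val_inj/succn_inj.
  have := root_in_tree (ltn0Sn i) (leqnn _) (ltn_ord i); rewrite E => H.
  by have [] := fam_disjoint FS (ltn0Sn i) (leqnn _) (ltn_ord i) (ltn0Sn i')
    (leqnn _) (ltn_ord i') H (root_in_tree (ltn0Sn i') (leqnn _) (ltn_ord i')).
apply/subset_leq_card/subsetP => x /imsetP[i _ ->].
have [l lc e] : exists2 l, l \in computed sch & edge (v i.+1 i.+1) l.
  have comp a m c : 0 < a -> a <= m -> m < c -> c <= n ->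
      leaf a m c \in computed sch.
    move=> a0 am mc cn; rewrite inE sch_all //.
    by apply: (tree_not_input a0 _ cn (leaf_in_tree a0 am mc cn)); lia.
  have lti := ltn_ord i.
  (* An input other than the last is the left operand of the leaf of a tree of span 1; the last is a
     right operand, and [1 < n] supplies its left neighbour. *)
  case: (ltnP i.+1 n) => lt.
    exists (leaf i.+1 i.+1 i.+2); first exact: comp.
    by have [] := @leaf_operands i.+1 i.+1 i.+2 isT (leqnn _) (leqnn _) lt.
  have i0 : 0 < i by lia.
  exists (leaf i i i.+1); first exact: comp.
  by have [] := @leaf_operands i i i.+1 i0 (leqnn _) (leqnn _) lti.
have := operand_in_cache sch_legal lc e; case: st_init => -> _.
rewrite set0U in_setU => /orP[//|/(computed_not_input sch_legal)].
by rewrite /is_input; have [_ ->] := fam_input FS (ltn0Sn i) (ltn_ord i); rewrite eqxx.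
Qed.

Lemma segments_io K N pre suf : 27 * M ^ 3 <= K ^ 2 -> sch = pre ++ suf ->
    N * K <= count op_leaf suf ->
  2 * M * N <= B * io_count suf + count op_root suf.
Proof.
move=> MK; elim: N pre suf => [|N IH] pre suf schE; first by rewrite muln0.
rewrite mulSn => le.
have [s1 [s2 [sufE c1]]] := split_count (leq_trans (leq_addr _ _) le).
move: le; rewrite sufE count_cat c1 leq_add2l => le2.
have E2 : sch = (pre ++ s1) ++ s2 by rewrite -catA -sufE.
have := IH _ _ E2 le2.
have schE' : sch = pre ++ s1 ++ s2 by rewrite -sufE.
have : 2 * M <= B * io_count s1 + count op_root s1.
  move: sch_legal sch_all sch_nr; rewrite schE' => h1 h2 h3.
  have := segment_leaves st_init h1 h2 h3; rewrite c1 => le3.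
  have := leq_trans MK le3; set q := _ + count _ _.
  (* Taking cube roots in [(3 * M) ^ 3 <= (M + q) ^ 3] gives [2 * M <= q]. *)
  rewrite -[27]/(3 ^ 3) -expnMn leq_exp2r //; lia.
rewrite /io_count !count_cat mulnDr mulnS; lia.
Qed.

Lemma schedule_io K : 0 < K -> 27 * M ^ 3 <= K ^ 2 ->
  exists N r, [/\ n ^ 3 <= 6 * (K * N.+1) + n, 2 * r <= n * n.+1 &
    2 * M * N <= B * io_count sch + r].
Proof.
(* [N] counts the complete segments; fewer than [K] leaves remain, whence [N.+1] in the bound on
   [n ^ 3]. *)
move=> K0 MK; exists (count op_leaf sch %/ K), #|root_vertices|; split.
- rewrite -card_leaf_vertices leq_add2r leq_mul2l /= mulnC.
  apply: leq_trans (_ : count op_leaf sch <= _); last exact/ltnW/ltn_ceil.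
  apply: leq_trans (card_computed_leq _ _); rewrite (setIidPr _) //.
  apply/subsetP => x /imsetP[[[i m] j]]; rewrite !inE /= => /and3P[i0 im mj] ->.
  apply: sch_all; apply: (tree_not_input i0 _ (leq_ord j)); first exact: leq_ltn_trans mj.
  exact: leaf_in_tree (leq_ord j).
- exact: card_root_vertices.
- apply: leq_trans (segments_io (pre := [::]) MK erefl (leq_trunc_div _ _)) _.
  rewrite leq_add2l; apply: leq_trans (count_computes_set _ sch_nr) _.
  exact: subset_leq_card (subsetIr _ _).
Qed.

End WholeSchedule.

End Family.

(** * The bound *)

Import Order.TTheory GRing.Theory Num.Theory.
Local Open Scope ring_scope.

(* [s] is the square root of [M]: by [hK], [K <= 16/3 * s ^+ 3], so each of the
   [N + 1] segments accounts for at most [2 * s ^+ 2] of the leading term. *)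
Lemma segment_count_bound (R : realFieldType) (s n M K N r q : R) :
    0 < s -> 0 <= K -> 0 <= N -> s ^+ 2 = M ->
    9%:R * K ^+ 2 <= 256%:R * M ^+ 3 ->
    n ^+ 3 <= 6%:R * (K * (N + 1)) + n -> 2%:R * r <= n * (n + 1) ->
    2%:R * M * N <= q + r ->
  (n ^+ 3 - n) / (16%:R * s) - n * (n + 1) / 2%:R - 3%:R * M <= q.
Proof.
move=> s0 K0 N0 sM hK hn hr hq.
have Ks : 3%:R * K <= 16%:R * s ^+ 3.
  rewrite -(ler_pXn2r (n := 2)) ?nnegrE ?mulr_ge0 ?exprn_ge0 ?(ltW s0) ?ler0n //.
  move: hK; rewrite -sM; lra.
have main : (n ^+ 3 - n) / (16%:R * s) <= 2%:R * M * (N + 1).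
  rewrite ler_pdivrMr ?mulr_gt0 ?ltr0n //.
  apply: le_trans (_ : 6%:R * (K * (N + 1)) <= _); first lra.
  rewrite -sM.
  have := ler_wpM2r (_ : 0 <= N + 1) Ks; move=> /(_ ltac:(lra)).
  rewrite (_ : 2%:R * s ^+ 2 * (N + 1) * (16%:R * s) = 2%:R * (16%:R * s ^+ 3 * (N + 1))); last by ring.
  lra.
(* Passing from [N + 1] to [N] costs [2 * M]; the term [3 * M] covers this because [M] is
   nonnegative. *)
have M0 : 0 <= M by rewrite -sM sqr_ge0.
lra.
Qed.

Theorem theorem3 (R : rcfType) (a b n M B : nat)
    (ha : (3 <= a)%N) (hb : (3 <= b)%N)
    (hn : n = (2 ^ a)%N) (hM : M = (2 ^ b)%N) (hB : (1 <= B)%N)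
    (G : cdag) (hG : in_family n G)
    (sch : seq (operation G))
    (hsch : computation_schedule M B sch)
    (hnr : no_recomputation sch) :
  Num.max ((n%:R ^+ 3 - n%:R) / (16%:R * Num.sqrt M%:R)
             - n%:R * (n%:R + 1) / 2%:R - 3%:R * M%:R)
          n%:R * (1 / B%:R) <= (io_count sch)%:R :> R.
Proof.
have M8 : (8 <= M)%N by rewrite hM -[8%N]/(2 ^ 3)%N leq_exp2l.
have n8 : (8 <= n)%N by rewrite hn -[8%N]/(2 ^ 3)%N leq_exp2l.
case: hG => v [T [lf FS]]; case: hsch => -[st st_init leg] all_ev.
have reads := input_reads FS st_init leg all_ev (leq_trans (isT : 1 < 8)%N n8).
have [K MK KM] := exists_segment_size M8.
have K0 : (0 < K)%N.
  by case: K MK {KM} => //; rewrite leqNgt muln_gt0 expn_gt0; lia.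
have [N [r [leN ler leq]]] := schedule_io FS st_init leg all_ev hnr K0 MK.
(* Clearing [B] splits the maximum into two bounds on the words moved; [reads] settles the
   second. *)
rewrite mul1r ler_pdivrMr ?ltr0n // ge_max -(natrM _ (io_count sch)) [(io_count _ * B)%N]mulnC ler_nat reads andbT.
apply: (@segment_count_bound _ _ _ _ K%:R N%:R r%:R); rewrite ?ler0n //.
- by rewrite sqrtr_gt0 ltr0n; lia.
- by rewrite sqr_sqrtr ?ler0n.
- by rewrite -!natrX -!natrM ler_nat.
- by rewrite natr1 -!natrX -!natrM -natrD ler_nat.
- by rewrite natr1 -!natrM ler_nat.
- by rewrite -!natrM -natrD ler_nat.
Qed.
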